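(* Let $\Gamma$ be a graph and let $\Lambda$ and $\Sigma$ be subgraphs of $\Gamma$ (possibly with $V(\Lambda)\neq V(\Sigma)$) such that $\Gamma=\Lambda\cup\Sigma$. Suppose that $\Lambda$ admits a nowhere-zero $3$-flow, and that every connected component $\Theta$ of $\Sigma$ is a generalized closed ladder satisfying: (i) $\Theta$ admits a nowhere-zero $3$-flow if it has no common edges with $\Lambda$; and (ii) each common edge of $\Theta$ and $\Lambda$, if any, is a rung of $\Theta$. Then $\Gamma$ admits a nowhere-zero $3$-flow.
   Context: Graphs are finite, undirected and loopless, with parallel edges allowed; the union of graphs takes unions of vertex sets and of edge sets. A $k$-flow in a graph is a pair $(D,\varphi)$ where $D$ is an orientation and $\varphi$ assigns an integer to each arc with $|\varphi(e)|<k$ and with flow conservation at every vertex; it is nowhere-zero if $\varphi$ never vanishes. For $n\ge2$, the circular ladder $CL_n$ is the Cayley graph of $\mathbb{Z}_n\times\mathbb{Z}_2$ with connection set $\{(1,0),(-1,0),(0,1)\}$ (for $n=2$ with parallel edges); its rungs are the edges $\{(i,0),(i,1)\}$ and its other edges are rail edges. The Möbius ladder $M_n$ ($n\ge2$) is the Cayley graph of $\mathbb{Z}_{2n}$ with connection set $\{1,-1,n\}$; its rungs are the edges $\{i,i+n\}$ and its other edges are rail edges. A generalized circular (resp. Möbius) ladder with $n\ge2$ rungs is obtained from $CL_n$ (resp. $M_n$) by replacing each rail edge by a path of length at least one (rungs stay rungs). By convention, graphs obtained from a generalized circular ladder with two rungs by deleting one or both rungs (two disjoint cycles joined by one edge,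 or two disjoint cycles) are generalized circular ladders with one rung or zero rungs, and graphs obtained from a generalized Möbius ladder with two rungs by deleting one or both rungs (a cycle with one chord, or a cycle) are generalized Möbius ladders with one rung (the chord) or zero rungs. A generalized closed ladder is a generalized circular or Möbius ladder. *)

(* Defs.v *)
From HB Require Import structures.
From mathcomp Require Import all_boot all_order all_algebra.

Set Implicit Arguments.
Unset Strict Implicit.
Unset Printing Implicit Defensive.

Import Order.TTheory GRing.Theory Num.Theory.
Local Open Scope ring_scope.

(* Finite, undirected, loopless multigraphs: every edge has a set of exactly
   two ends, and distinct edges may have the same ends. *)
Record mgraph := MGraph {
  vertex : finType;
  edge : finType;
  ends : edge -> {set vertex};
  card_ends : forall e, #|ends e| = 2%N
}.

Record orientation (G : mgraph) := Orientation {
  arc_tail : edge G -> vertex G;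
  arc_head : edge G -> vertex G;
  ends_orient : forall e, ends e = [set arc_tail e; arc_head e]
}.

Definition is_flow (G : mgraph) (k : nat) (D : orientation G)
    (phi : edge G -> int) : Prop :=
  (forall e, `|phi e| < k%:Z) /\
  (forall v, \sum_(e | arc_tail D e == v) phi e =
             \sum_(e | arc_head D e == v) phi e).

Definition admits_nowhere_zero_flow (k : nat) (G : mgraph) : Prop :=
  exists (D : orientation G) (phi : edge G -> int),
    is_flow k D phi /\ (forall e, phi e <> 0).

Record subgraph (G : mgraph) := Subgraph {
  vset : {set vertex G};
  eset : {set edge G};
  eset_closed : forall e, e \in eset -> ends e \subset vset
}.

Section SubgraphGraph.
Variables (G : mgraph) (H : subgraph G).

Definition sub_vertex : finType := {v : vertex G | v \in vset H}.
Definition sub_edge : finType := {e : edge G | e \in eset H}.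
Definition sub_ends (e : sub_edge) : {set sub_vertex} :=
  [set v | val v \in ends (val e)].

Lemma card_sub_ends e : #|sub_ends e| = 2%N.
Proof.
rewrite -(card_ends (val e)) -(card_imset _ val_inj); apply: eq_card => v.
apply/imsetP/idP => [[w + ->]|ve]; first by rewrite inE.
have vH : v \in vset H by apply: subsetP ve; apply: eset_closed (valP e).
by exists (Sub v vH); rewrite ?inE.
Qed.

Definition graph_of_subgraph : mgraph := MGraph card_sub_ends.

End SubgraphGraph.

Coercion graph_of_subgraph : subgraph >-> mgraph.

Definition subgraph_le (G : mgraph) (H K : subgraph G) : Prop :=
  (vset H \subset vset K) /\ (eset H \subset eset K).

Definition is_union (G : mgraph) (H K : subgraph G) : Prop :=
  vset H :|: vset K = [set: vertex G] /\ eset H :|: eset K = [set: edge G].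

Definition adjacent (G : mgraph) : rel (vertex G) :=
  fun x y => [exists e, ends e == [set x; y]].

Definition connected (G : mgraph) : Prop :=
  (exists x : vertex G, True) /\
  (forall x y : vertex G, connect (@adjacent G) x y).

Definition is_component (G : mgraph) (T S : subgraph G) : Prop :=
  [/\ subgraph_le T S, connected T
    & forall T' : subgraph G,
        subgraph_le T' S -> connected T' -> subgraph_le T T' ->
        subgraph_le T' T].

Section Arcs.
Variables (V E : finType) (s t : E -> V).
Hypothesis st_neq : forall e, s e != t e.

Lemma card_arc_ends e : #|[set s e; t e]| = 2%N.
Proof. by rewrite cards2 st_neq. Qed.

Definition arc_graph : mgraph := MGraph card_arc_ends.

Definition arc_orientation : orientation arc_graph :=
  @Orientation arc_graph s t (fun e => erefl).

End Arcs.

(* [subdivide D inner] replaces each edge e by a path of length (inner e).+1,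
   that is, with [inner e] new internal vertices.  The orientation only fixes
   the direction in which these are numbered. *)
Section Subdivide.
Variables (G : mgraph) (D : orientation G) (inner : edge G -> nat).

Definition sd_vertex : finType := (vertex G + {e : edge G & 'I_(inner e)})%type.
Definition sd_edge : finType := {e : edge G & 'I_(inner e).+1}.

(* The k-th vertex on the path replacing e, 0 <= k <= (inner e).+1. *)
Definition sd_path (e : edge G) (k : nat) : sd_vertex :=
  if k is j.+1 then
    if (insub j : option 'I_(inner e)) is Some i
    then inr (Tagged (fun e => 'I_(inner e)) i)
    else inl (arc_head D e)
  else inl (arc_tail D e).

Lemma sd_path_neq (x : sd_edge) :
  sd_path (tag x) (tagged x) != sd_path (tag x) (tagged x).+1.
Proof.
case: x => e [[|j] /= ltj].
  case: insubP => //= _; apply/eqP => -[eq_th].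
  by have := card_ends e; rewrite (ends_orient D) eq_th setUid cards1.
rewrite insubT /=; case: insubP => //= i _ ij.
apply/eqP => -[] /eqP; rewrite eq_Tagged /= => /eqP /(congr1 val) /= /eqP.
by rewrite ij ltn_eqF.
Qed.

Definition subdivide : mgraph := arc_graph sd_path_neq.

End Subdivide.

Record ladder := Ladder {
  ladder_graph :> mgraph;
  ladder_dir : orientation ladder_graph;
  rungs : {set edge ladder_graph}
}.

(* The Cayley graph of Z_n x Z_2 (n >= 2) for {(1,0), (-1,0), (0,1)}: the rails
   are inl (i, j), joining (i, j) and (i + 1, j), and the rungs are inr i,
   joining (i, 0) and (i, 1).  For n = 2 the rails (0, j) and (1, j) are
   parallel.  'Z_n is Z_n only for n >= 2. *)
Section CircularLadder.
Variable n : nat.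

Definition cl_vertex : finType := ('Z_n * 'Z_2)%type.
Definition cl_edge : finType := (('Z_n * 'Z_2) + 'Z_n)%type.
Definition cl_src (e : cl_edge) : cl_vertex :=
  match e with inl (i, j) => (i, j) | inr i => (i, 0) end.
Definition cl_tgt (e : cl_edge) : cl_vertex :=
  match e with inl (i, j) => (i + 1, j) | inr i => (i, 1) end.

Lemma cl_neq e : cl_src e != cl_tgt e.
Proof.
case: e => [[i j]|i] /=; rewrite xpair_eqE ?eqxx ?andbT //.
by rewrite -subr_eq0 opprD addNKr oppr_eq0 oner_eq0.
Qed.

Definition circular_ladder : ladder :=
  Ladder (arc_orientation cl_neq) [set e : cl_edge | ~~ is_inl e].

End CircularLadder.

(* The Cayley graph of Z_2n (n >= 2) for {1, -1, n}: the rails are inl i,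
   joining i and i + 1, and the n rungs are inr i, joining i and i + n. *)
Section MoebiusLadder.
Variable n : nat.

Definition ml_vertex : finType := 'Z_(2 * n).
Definition ml_edge : finType := ('Z_(2 * n) + 'I_n)%type.
Definition ml_src (e : ml_edge) : 'Z_(2 * n) :=
  match e with inl i => i | inr i => (i : nat)%:R end.
Definition ml_tgt (e : ml_edge) : 'Z_(2 * n) :=
  match e with inl i => i + 1 | inr i => (i : nat)%:R + n%:R end.

Lemma ml_neq e : (ml_src e : ml_vertex) != ml_tgt e.
Proof.
case: e => i /=; rewrite eq_sym -subr_eq0 addrC addKr ?oner_eq0 //.
have n_gt0 : (0 < n)%N by apply: leq_ltn_trans (ltn_ord i).
have n2_gt1 : (1 < 2 * n)%N by rewrite mul2n -addnn (leq_add n_gt0 n_gt0).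
rewrite -val_eqE /= val_Zp_nat // modn_small ?lt0n_neq0 //.
by rewrite mul2n -addnn -addn1 leq_add2l.
Qed.

Definition moebius_ladder : ladder :=
  Ladder (arc_orientation ml_neq) [set e : ml_edge | ~~ is_inl e].

End MoebiusLadder.

(* Isomorphism of graphs with distinguished sets of edges. *)
Definition isomorphic (G : mgraph) (R : {set edge G})
    (H : mgraph) (S : {set edge H}) : Prop :=
  exists (f : vertex G -> vertex H) (g : edge G -> edge H),
    [/\ bijective f, bijective g,
        forall e, ends (g e) = f @: ends e & S = g @: R].

Section DeleteEdges.
Variables (G : mgraph) (X : {set edge G}).

Lemma delete_closed e : e \in ~: X -> ends e \subset [set: vertex G].
Proof. by rewrite subsetT. Qed.

Definition delete_edges : subgraph G := Subgraph delete_closed.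

End DeleteEdges.

(* H, with set of rungs R, is obtained from L by replacing each rail by a path
   of length at least one. *)
Definition generalizes (L : ladder) (H : mgraph) (R : {set edge H}) : Prop :=
  exists inner : edge L -> nat,
    (forall e, e \in rungs L -> inner e = 0%N) /\
    isomorphic (G := subdivide (ladder_dir L) inner)
      [set x : sd_edge inner | tag x \in rungs L] R.

(* A graph can be a generalized ladder in several ways (K_4, for instance), so
   the set R of rungs is part of the data.  The second disjunct gives the
   generalized ladders with one rung or no rung. *)
Definition generalized_ladder (L : nat -> ladder)
    (H : mgraph) (R : {set edge H}) : Prop :=
  (exists n : nat, (2 <= n)%N /\ generalizes (L n) R) \/
  (exists (H2 : mgraph) (R2 X : {set edge H2}),
     [/\ generalizes (L 2%N) R2, X \subset R2, X != set0
       & isomorphic (G := delete_edges X)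
           [set e : sub_edge (delete_edges X) | val e \in R2] R]).

Definition generalized_closed_ladder (H : mgraph) (R : {set edge H}) : Prop :=
  generalized_ladder circular_ladder R \/ generalized_ladder moebius_ladder R.

(* Main.v *)
Require Import Defs.
From mathcomp Require Import all_boot all_order all_algebra.
From mathcomp Require Import zify ring.

Set Implicit Arguments.
Unset Strict Implicit.
Unset Printing Implicit Defensive.

Import Order.TTheory GRing.Theory Num.Theory.
Local Open Scope ring_scope.

(* Flows are handled modulo 3 and lifted to integer 3-flows at the end: among
   the lifts with values in {1, -2} (for the orientation in which every edge has
   value 1 modulo 3), one minimising the total absolute excess has excess 0,
   since otherwise flipping the edges of a residual path from a vertex of
   positive excess to one of negative excess would improve it.

   The flow on Lambda is corrected separately on each component Theta of Sigma
   that shares an edge with it.  On a closed ladder, put opposite values s and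
   -s on the two rails; the rung values are then the differences of consecutive
   s.  A rung outside Lambda forces s to change sign; a rung of Lambda of value
   p allows s to stay, and also to change sign if s = -p just before it.  Going
   once around, the number of sign changes has to be even (circular ladder) or
   odd (Moebius ladder), and one rung in Lambda suffices to adjust the parity. *)

(** * Half-edge functions *)

(* [h v e] is the amount that leaves [v] along [e]; this describes flows
   without choosing an orientation. *)
Definition skew_half (A : zmodType) (G : mgraph)
    (h : vertex G -> edge G -> A) :=
  (forall v e, v \notin ends e -> h v e = 0) /\ (forall e, \sum_v h v e = 0).

Definition conserves (A : zmodType) (G : mgraph)
    (h : vertex G -> edge G -> A) :=
  forall v, \sum_e h v e = 0.

(** Bare end maps [s] and [t] let the formula apply directly to the paths of a subdivision as
    well. *)
Definition arc_half (A : zmodType) (V E : eqType) (s t : E -> V) (a : E -> A)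
    (v : V) (e : E) : A :=
  a e *+ (s e == v) - a e *+ (t e == v).

Lemma sum_mulrb_eq (A : zmodType) (I : finType) (c : A) (i : I) :
  \sum_j c *+ (i == j) = c.
Proof.
rewrite (bigD1 i) //= eqxx mulr1n big1 ?addr0 // => j ji.
by rewrite eq_sym (negbTE ji).
Qed.

Lemma sum_mulrb (A : zmodType) (I : finType) (P : pred I) (F : I -> A) :
  \sum_i F i *+ P i = \sum_(i | P i) F i.
Proof.
by rewrite [RHS]big_mkcond; apply: eq_bigr => i _; case: (P i).
Qed.

Lemma sum_inj (A : zmodType) (I J : finType) (f : I -> J) (F : J -> A) :
  injective f -> (forall j, j \notin codom f -> F j = 0) ->
  \sum_i F (f i) = \sum_j F j.
Proof.
move=> f_inj F0; rewrite [RHS](bigID (mem (codom f))) /=.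
rewrite [X in _ + X]big1 ?addr0 // -big_uniq /=; last exact/injectiveP.
by rewrite big_map big_enum.
Qed.

Lemma arc_half_conservesE (A : zmodType) (V E : finType) (s t : E -> V)
    (a : E -> A) v :
  \sum_e arc_half s t a v e =
  \sum_(e | s e == v) a e - \sum_(e | t e == v) a e.
Proof. by rewrite sumrB !sum_mulrb. Qed.

Section Orientation.
Variables (A : zmodType) (G : mgraph) (D : orientation G).

Lemma arc_neq e : arc_tail D e != arc_head D e.
Proof.
by have := card_ends e; rewrite (ends_orient D) cards2; case: eqVneq.
Qed.

Lemma arc_half_skew (a : edge G -> A) :
  skew_half (arc_half (arc_tail D) (arc_head D) a).
Proof.
split=> [v e|e]; last by rewrite sumrB !sum_mulrb_eq subrr.
rewrite (ends_orient D) !inE negb_or /arc_half ![v == _]eq_sym.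
by case/andP=> /negbTE -> /negbTE ->; rewrite subrr.
Qed.

Lemma arc_half_eq0 (a : edge G -> A) v e :
  v \in ends e ->
  (arc_half (arc_tail D) (arc_head D) a v e == 0) = (a e == 0).
Proof.
rewrite (ends_orient D) !inE /arc_half => /orP[] /eqP ->; rewrite eqxx.
  by rewrite [arc_head D e == _]eq_sym (negbTE (arc_neq e)) subr0.
by rewrite (negbTE (arc_neq e)) sub0r oppr_eq0.
Qed.

(** Only the two ends of an edge contribute to its zero sum, so the value at the head is opposite to
    the one at the tail. *)
Lemma skew_arc_half (h : vertex G -> edge G -> A) :
  skew_half h ->
  forall v e,
    h v e =
    arc_half (arc_tail D) (arc_head D) (fun e => h (arc_tail D e) e) v e.
Proof.
case=> h0 hs v e; rewrite /arc_half.
have [<-|vt] := eqVneq (arc_tail D e) v.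
  by rewrite [arc_head D e == _]eq_sym (negbTE (arc_neq e)) subr0.
have [<-|vh] := eqVneq (arc_head D e) v; last first.
  by rewrite h0 ?subrr // (ends_orient D) !inE ![v == _]eq_sym negb_or vt vh.
apply/eqP; rewrite sub0r -addr_eq0 addrC -(hs e) (bigD1 (arc_tail D e)) //=.
rewrite (bigD1 (arc_head D e)) /= ?[arc_head D e == _]eq_sym ?arc_neq //.
rewrite big1 ?addr0 // => w /andP[wt wh].
by rewrite h0 // (ends_orient D) !inE negb_or wt wh.
Qed.

End Orientation.

(** * Embeddings of graphs *)

Section Embedding.
Variables (A : zmodType) (G H : mgraph).
Variables (f : vertex G -> vertex H) (g : edge G -> edge H).
Hypotheses (f_inj : injective f) (g_inj : injective g).
Hypothesis ends_fg : forall e, ends (g e) = f @: ends e.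

(** Extension by zero along the embedding. Summing over fibres avoids partial inverses of [f] and
    [g], and turns conservation into a regrouping of sums. *)
Definition push_half (h : vertex G -> edge G -> A) v' e' : A :=
  \sum_(v | f v == v') \sum_(e | g e == e') h v e.

Lemma push_halfE h v e : push_half h (f v) (g e) = h v e.
Proof.
rewrite /push_half (eq_bigl (pred1 v)) => [|w]; last by rewrite /= inj_eq.
rewrite big_pred1_eq (eq_bigl (pred1 e)) => [|e1]; last by rewrite /= inj_eq.
by rewrite big_pred1_eq.
Qed.

Lemma push_half_out h v' e' : (forall e, g e != e') -> push_half h v' e' = 0.
Proof.
by move=> ge'; apply: big1 => v _; apply: big1 => e; rewrite (negbTE (ge' e)).
Qed.

Lemma push_half_skew h : skew_half h -> skew_half (push_half h).
Proof.
case=> h0 hs; split=> [v' e' v'e'|e'].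
  apply: big1 => v /eqP fv; apply: big1 => e /eqP ge; apply: h0.
  apply: contraNN v'e' => ve.
  by rewrite -ge -fv ends_fg imset_f.
transitivity (\sum_v \sum_(e | g e == e') h v e).
  by rewrite [RHS](partition_big f xpredT).
by rewrite exchange_big big1 //= => e _.
Qed.

Lemma push_half_conserves h : conserves h -> conserves (push_half h).
Proof.
move=> hc v'; rewrite /push_half exchange_big big1 //= => v _.
by rewrite -[RHS](hc v) [RHS](partition_big g xpredT).
Qed.

(** Both ends of [g e] lie in the image of [f], so the pullback loses no nonzero term of the sum
    over vertices. *)
Lemma pull_half_skew (h : vertex H -> edge H -> A) :
  skew_half h -> skew_half (fun v e => h (f v) (g e)).
Proof.
case=> h0 hs; split=> [v e ve|e].
  by rewrite h0 // ends_fg (mem_imset _ _ f_inj).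
rewrite -[RHS](hs (g e)) -[RHS](sum_inj (f := f)) // => v.
apply: contraNeq => hv.
have : v \in ends (g e) by apply: contraR hv => /h0 ->.
by rewrite ends_fg => /imsetP[w _ ->]; apply: codom_f.
Qed.

Lemma pull_half_conserves (h : vertex H -> edge H -> A) :
  (forall v e', e' \notin codom g -> h v e' = 0) ->
  conserves h -> conserves (fun v e => h (f v) (g e)).
Proof.
move=> h0 hc v; rewrite -[RHS](hc (f v)) -[RHS](sum_inj (f := g)) // => e.
exact: h0.
Qed.

End Embedding.

Lemma ends_sub_val (G : mgraph) (H : subgraph G) (e : sub_edge H) :
  ends (val e) = val @: @ends (graph_of_subgraph H) e.
Proof.
apply/setP=> v; apply/idP/imsetP => [ve|[w + ->]]; last by rewrite inE.
have vH : v \in vset H by apply: subsetP ve; apply: eset_closed (valP e).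
by exists (Sub v vH); rewrite ?inE.
Qed.

(** * From flows modulo 3 to integer flows *)

Section ModThree.
Variables (G : mgraph) (D : orientation G).
Implicit Types (B : {set edge G}) (x y v : vertex G).

(* The integers congruent to 1 modulo 3 and of absolute value less than 3. *)
Definition lift3 B (e : edge G) : int := if e \in B then - 2 else 1.

Definition excess B v : int :=
  \sum_e arc_half (arc_tail D) (arc_head D) (lift3 B) v e.

(** Under [lift3 B], [e] carries a positive amount from [x] to [y]: 1 along its orientation, or 2
    against it. *)
Definition pos_arc B e x y :=
  if e \in B then (arc_head D e == x) && (arc_tail D e == y)
  else (arc_tail D e == x) && (arc_head D e == y).

Definition residual B : rel (vertex G) :=
  fun x y => [exists e, pos_arc B e x y].

Definition flip B e : {set edge G} := [set e1 | (e1 \in B) (+) (e1 == e)].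

Lemma excess_flip B e x y v : pos_arc B e x y ->
  excess (flip B e) v = excess B v - 3 *+ (x == v) + 3 *+ (y == v).
Proof.
move=> exy; rewrite /excess !(bigD1 (P := xpredT) e) //=.
rewrite (eq_bigr (arc_half (arc_tail D) (arc_head D) (lift3 B) v)); last first.
  by move=> e1 e1e; rewrite /arc_half /lift3 inE (negbTE e1e) addbF.
rewrite ![_ + \sum_(_ | _) _]addrC -!addrA; congr (_ + _).
rewrite /arc_half /lift3 inE eqxx addbT; move: exy; rewrite /pos_arc.
case: (e \in B) => /andP[/eqP-> /eqP->] /=;
  by case: (x == v); case: (y == v).
Qed.

(** The edges are flipped one after another, and the changes at inner vertices cancel. As the path
    is simple, its later arcs avoid [x]; the first edge carries its positive amount out of [x], so
    flipping it leaves them intact. *)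
Lemma excess_path B x p : path (residual B) x p -> uniq (x :: p) ->
  exists B', forall v,
    excess B' v = excess B v - 3 *+ (x == v) + 3 *+ (last x p == v).
Proof.
elim: p B x => [|y p IHp] B x /=.
  by exists B => v; rewrite subrK.
case/andP=> /existsP[e exy] pth; rewrite inE negb_or -andbA.
case/and3P=> xy xp uyp.
have [|B' B'E] := IHp (flip B e) y _ uyp.
  apply: (sub_in_path (P := [pred z | z != x])) pth; last first.
    rewrite /= eq_sym xy; apply/allP => z zp.
    by rewrite inE; apply: contraNneq xp => <-.
  move=> u w; rewrite !inE => ux wx /existsP[e1 e1uw].
  have e1e : e1 != e.
    apply: contraTneq e1uw => ->; move: exy; rewrite /pos_arc.
    case: ifP => _ /andP[/eqP-> /eqP->];
    by rewrite [x == u]eq_sym (negbTE ux).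
  apply/existsP; exists e1.
  by rewrite /pos_arc inE (negbTE e1e) addbF.
by exists B' => v; rewrite B'E (excess_flip _ exy) addrK.
Qed.

Lemma sum_excess B : \sum_v excess B v = 0.
Proof.
rewrite exchange_big big1 //= => e _.
by have [_ ->] := arc_half_skew D (lift3 B).
Qed.

Lemma excess_modn B v : excess B v = excess set0 v %[mod 3]%Z.
Proof.
apply/eqP; rewrite eqz_mod_dvd -sumrB; apply: rpred_sum => e _.
rewrite /arc_half /lift3 inE.
by case: (e \in B); case: (_ == v); case: (_ == v).
Qed.

(* Every arc that carries a positive value between [U] and its complement
   points into [U]. *)
Lemma sum_excess_closed B (U : {set vertex G}) :
  (forall x y, x \in U -> residual B x y -> y \in U) ->
  \sum_(v in U) excess B v <= 0.
Proof.
move=> Ucl; rewrite exchange_big /=; apply: sumr_le0 => e _.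
rewrite /arc_half sumrB.
have sumU c w : \sum_(v in U) c *+ (w == v) = c *+ (w \in U) :> int.
  rewrite big_mkcond /= -(sum_mulrb_eq (c *+ (w \in U)) w).
  apply: eq_bigr => v _; case: eqVneq => [->|]; first by case: (v \in U).
  by case: (v \in U) => //=; rewrite !mulr0n.
rewrite !sumU /lift3.
have [eB|eB] := boolP (e \in B).
  have := Ucl (arc_head D e) (arc_tail D e).
  case: (_ \in U); case: (_ \in U) => //= /(_ isT).
  by have -> // : residual B (arc_head D e) (arc_tail D e);
    [apply/existsP; exists e; rewrite /pos_arc eB !eqxx | move/(_ isT)].
have := Ucl (arc_tail D e) (arc_head D e).
case: (_ \in U); case: (_ \in U) => //= /(_ isT).
by have -> // : residual B (arc_tail D e) (arc_head D e);
  [apply/existsP; exists e; rewrite /pos_arc (negbTE eB) !eqxx | move/(_ isT)].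
Qed.

Lemma exists_excess0 :
  (forall v, 3 %| excess set0 v)%Z -> exists B, forall v, excess B v = 0.
Proof.
move=> div3.
have div3B B v : (3 %| excess B v)%Z.
  by apply/dvdz_mod0P; rewrite excess_modn; apply/dvdz_mod0P.
pose m B := (\sum_v absz (excess B v))%N.
case: (@arg_minnP _ (set0 : {set edge G}) xpredT m isT) => B _ Bmin.
have [/forallP all0|] := boolP [forall v, excess B v == 0].
  by exists B => v; apply/eqP.
rewrite negb_forall => /existsP[v0 v0_neq0].
have /existsP[x x_gt0] : [exists x, 0 < excess B x].
  apply: contraNT v0_neq0; rewrite negb_exists => /forallP le0.
  rewrite -oppr_eq0; apply/eqP.
  apply: (@psumr_eq0P _ _ xpredT (fun v => - excess B v)) => // [v _|].
    by rewrite oppr_ge0 leNgt.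
  by rewrite sumrN sum_excess oppr0.
pose U := [set y | connect (residual B) x y].
have xU : x \in U by rewrite inE connect0.
(* [U] is closed under residual arcs, so its total excess is at most 0, although [x] contributes a
   positive term. *)
have /existsP[y /andP[yU y_lt0]] : [exists y, (y \in U) && (excess B y < 0)].
  rewrite -[X in is_true X]negbK negb_exists; apply/negP => /forallP ge0.
  suff : \sum_(v in U) excess B v <= 0.
    rewrite (bigD1 x) //= leNgt ltr_wpDr //; apply: sumr_ge0 => v /andP[vU _].
    by move: (ge0 v); rewrite vU /= -leNgt.
  apply: sum_excess_closed => u w; rewrite !inE => xu uw.
  exact: connect_trans xu (connect1 uw).
move: yU; rewrite inE => /connectP[p0 /shortenP[p pth up _] yl].
have [B' B'E] := excess_path pth up.
have := Bmin B' isT; rewrite leqNgt => /negP[].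
have yx : y != x by apply: contraTneq y_lt0 => ->; rewrite -leNgt ltW.
(* By divisibility the excess is at least 3 at [x] and at most -3 at [y], so a shift by 3 overshoots
   0 at neither end. *)
rewrite /m !(bigD1 (P := xpredT) x) //= -addSn; apply: leq_add.
  have := div3B B x; rewrite B'E -yl eqxx (negbTE yx) /=; move: x_gt0; lia.
apply: leq_sum => v vx; rewrite B'E -yl [x == v]eq_sym (negbTE vx) /=.
have [<-|] := eqVneq y v; last by rewrite !mulr0n subr0 addr0.
by have := div3B B y; move: y_lt0; lia.
Qed.

End ModThree.

Lemma F3_neq0 (x : 'F_3) : x != 0 -> x = 1 \/ x = -1.
Proof.
by case: x => -[|[|[|//]]] //= i _; [left|right]; apply: val_inj.
Qed.

Lemma intr_F3_eq0 (z : int) : ((z%:~R : 'F_3) == 0) = (3 %| z)%Z.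
Proof. by rewrite (dvdz_pcharf (pchar_Fp (isT : prime 3))). Qed.

Lemma flow3_of_mod3 (G : mgraph) (h : vertex G -> edge G -> 'F_3) :
  skew_half h -> conserves h -> (forall v e, v \in ends e -> h v e != 0) ->
  admits_nowhere_zero_flow 3 G.
Proof.
move=> hs hc hn0.
have /fin_all_exists[st stE] (e : edge G) : exists st : vertex G * vertex G,
    ends e = [set st.1; st.2] /\ h st.1 e = 1.
  have /eqP/cards2P[x [y [xy exy]]] := card_ends e.
  have xe : x \in ends e by rewrite exy !inE eqxx.
  have [hx|hx] := F3_neq0 (hn0 x e xe); first by exists (x, y).
  exists (y, x); rewrite /= setUC; split=> //.
  apply/eqP; rewrite -[1]opprK -hx -addr_eq0 addrC.
  have [h0 /(_ e) <-] := hs; rewrite (bigD1 x) //= (bigD1 y) 1?eq_sym //=.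
  rewrite big1 ?addr0 // => w /andP[wx wy].
  by rewrite h0 // exy !inE negb_or wx wy.
pose D := @Orientation G (fun e => (st e).1) (fun e => (st e).2)
  (fun e => (stE e).1).
have [v|B B0] := @exists_excess0 _ D; last first.
  exists D, (lift3 B); split; last by move=> e; rewrite /lift3; case: ifP.
  split=> [e|v]; first by rewrite /lift3; case: ifP.
  by apply/eqP; rewrite -subr_eq0 -arc_half_conservesE; apply/eqP/B0.
(* The lift with all values 1 reduces to [h] modulo 3, so conservation of [h] makes its excess
   divisible by 3. *)
rewrite -intr_F3_eq0 rmorph_sum /=; apply/eqP; rewrite -[RHS](hc v).
apply: eq_bigr => e _.
rewrite (skew_arc_half D hs) /arc_half (stE e).2 /lift3 inE /=.
by rewrite rmorphB !rmorphMn /=.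
Qed.

Lemma mod3_of_flow3 (G : mgraph) : admits_nowhere_zero_flow 3 G ->
  exists h : vertex G -> edge G -> 'F_3,
    [/\ skew_half h, conserves h & forall v e, v \in ends e -> h v e != 0].
Proof.
case=> D [phi [[phi3 phic] phi0]].
exists (arc_half (arc_tail D) (arc_head D) (fun e => (phi e)%:~R)); split.
- exact: arc_half_skew.
- by move=> v; rewrite arc_half_conservesE -!rmorph_sum /= phic subrr.
move=> v e ve; rewrite arc_half_eq0 // intr_F3_eq0.
by move: (phi3 e) (phi0 e); lia.
Qed.

(** * Ladders *)

(* [s i] is the value on the rail before rung [i]; [d] marks deleted rungs and
   [- p i] is the value forbidden on rung [i].  The step at [i0] is free, which
   makes the prescribed monodromy [eps] attainable. *)
Lemma rail_sequence n (d : pred 'I_n) (p : 'I_n -> 'F_3) (i0 : 'I_n)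
    (eps : 'F_3) :
  ~~ d i0 -> p i0 != 0 -> eps != 0 ->
  exists s : nat -> 'F_3,
    [/\ forall i, s i != 0, s n = eps * s 0%N,
        forall i : 'I_n, d i -> s i - s i.+1 = 0
      & forall i : 'I_n, ~~ d i -> s i - s i.+1 + p i != 0].
Proof.
move=> di0 pi0 eps0.
(* The ratio of [s i.+1] to [s i]: the sign changes exactly where a remaining rung would otherwise
   get value 0. *)
pose w (i : 'I_n) : 'F_3 := if ~~ d i && (p i == 0) then -1 else 1.
pose c := \prod_(i < n | i != i0) w i.
have w0 i : w i != 0 by rewrite /w; case: ifP.
have c0 : c != 0 by apply/prodf_neq0.
(* The ratio at [i0] is adjusted so that the product of all ratios is [eps]. *)
pose W (i : 'I_n) := if i == i0 then eps / c else w i.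
have W0 i : W i != 0.
  by rewrite /W; case: ifP => // _; rewrite mulf_neq0 ?invr_eq0.
pose Wn i := oapp W 1 (insub i).
have WnE (i : 'I_n) : Wn i = W i by rewrite /Wn valK.
have Wn0 i : Wn i != 0 by rewrite /Wn; case: insub.
pose P i := \prod_(j < i) Wn j.
have P0 i : P i != 0 by apply/prodf_neq0.
(* The scaling gives [s i0 = - p i0], so the total on rung [i0] is [- s i0.+1], nonzero whatever the
   ratio there. *)
exists (fun i => - p i0 / P i0 * P i); split=> [i|||].
- by rewrite !mulf_neq0 ?oppr_eq0 ?invr_eq0.
- rewrite [P 0%N]/P big_ord0 mulr1 mulrC; congr (_ * _).
  rewrite /P (bigD1 i0) //= WnE /W eqxx (eq_bigr w) ?divfK // => i.
  by rewrite WnE /W => /negbTE ->.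
- move=> i di; rewrite [P i.+1]/P big_ord_recr /= -/(P i) WnE /W.
  case: eqP => [ii0|_]; first by rewrite -ii0 di in di0.
  by rewrite /w di mulr1 subrr.
move=> i di; rewrite [P i.+1]/P big_ord_recr /= -/(P i) WnE /W.
have [->|_] := eqVneq i i0.
  rewrite [_ * (P i0 * _)]mulrA divfK // mulNr opprK addrAC addNr add0r.
  by rewrite !mulf_neq0 ?invr_eq0.
rewrite /w di /=; have [->|pi] := eqVneq (p i) 0.
  rewrite addr0 mulrA mulrN1 opprK -mulr2n -mulr_natl.
  by rewrite !mulf_neq0 ?oppr_eq0 ?invr_eq0.
by rewrite mulr1 subrr add0r.
Qed.

(** The correction property on the ladder before subdivision: [a] is a flow to be added to [p], and
    [d] marks deleted rungs. The condition on rails omits [p] because the values to be corrected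
    live on rungs. *)
Definition ladder_switch (L : ladder) :=
  forall (d : pred (edge L)) (p : edge L -> 'F_3) (e0 : edge L),
    e0 \in rungs L -> ~~ d e0 -> p e0 != 0 ->
  exists a : edge L -> 'F_3,
    [/\ forall v, \sum_e arc_half (arc_tail (ladder_dir L))
                           (arc_head (ladder_dir L)) a v e = 0,
        forall e, e \notin rungs L -> a e != 0,
        forall e, e \in rungs L -> d e -> a e = 0
      & forall e, e \in rungs L -> ~~ d e -> a e + p e != 0].

(** This handles the wraparound at [u = 0], where [(u - 1).+1] is the order [(Zp_trunc n).+2] of the
    group instead of 0. *)
Lemma val_Zp_sub1S (T : Type) n (s : nat -> T) (u : 'Z_n) :
  s (Zp_trunc n).+2 = s 0%N -> s (u - 1)%R.+1 = s u.
Proof.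
move=> sn; rewrite -{2}(subrK 1 u); move: (u - 1) => {}u /=.
rewrite modnDmr addn1.
have := ltn_ord u; rewrite leq_eqVlt => /orP[/eqP ->|lt_u].
  by rewrite modnn.
by rewrite modn_small.
Qed.

(** One turn brings each of the two rail cycles back to its start, so the monodromy has to be 1. *)
Lemma circular_ladder_switch n : ladder_switch (circular_ladder n).
Proof.
move=> d p [x|i0]; rewrite inE //= => _ di0 pi0.
have [s [s0 sn sd sp]] :=
  rail_sequence (d := fun i => d (inr i)) (p := fun i => p (inr i)) di0 pi0
    (oner_neq0 _).
rewrite mul1r in sn.
(* Rail [(i, j)] leaves rung [i], hence the index [i.+1]; the rung carries the drop in value along
   rail 0, which equals the rise along rail 1. *)
exists (fun e : cl_edge n => match e with
  | inl (i, j) => if j == 0 then s i.+1 else - s i.+1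
  | inr i => s i - s i.+1 end); split.
- case=> u k; rewrite arc_half_conservesE !big_sumType /=.
  have := val_Zp_sub1S u sn.
  have : (fun x : 'Z_n * 'Z_2 => cl_tgt (inl x) == (u, k)) =1 pred1 (u - 1, k).
    by case=> i j; rewrite /= !xpair_eqE [i == _]eq_sym subr_eq [u == _]eq_sym.
  move: (u - 1) => w tgtE sw.
  rewrite (big_pred1 (u, k)) /=; last by case.
  rewrite (big_pred1 (w, k)) //= sw.
  have [->|->] : k = 0 \/ k = 1.
    by case: k {tgtE} => -[|[|//]] ?; [left|right]; apply: val_inj.
    rewrite eqxx (big_pred1 u) => [|i]; last by rewrite /= xpair_eqE andbT.
    rewrite [\sum_(_ | _) _]big_pred0 => [|i]; last by rewrite xpair_eqE andbF.
    by ring.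
  rewrite /= big_pred0 => [|i]; last by rewrite xpair_eqE andbF.
  rewrite (big_pred1 u) => [|i]; last by rewrite /= xpair_eqE andbT.
  by ring.
- case=> [[i j]|i]; rewrite inE //= => _.
  by case: ifP; rewrite ?oppr_eq0.
- by case=> [[i j]|i]; rewrite inE //= => _; apply: sd.
by case=> [[i j]|i]; rewrite inE //= => _; apply: sp.
Qed.

(** The rails form one cycle of length [2 * n] whose second half plays the opposite rail; passing
    from one half to the other requires monodromy -1. *)
Lemma moebius_ladder_switch n : (2 <= n)%N -> ladder_switch (moebius_ladder n).
Proof.
move=> n_ge2 d p [x|i0]; rewrite inE //= => _ di0 pi0.
have [s [s0 sn sd sp]] :=
  rail_sequence (d := fun i => d (inr i)) (p := fun i => p (inr i)) di0 pi0
    (isT : (-1 : 'F_3) != 0).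
rewrite mulN1r in sn.
have n2_gt1 : (1 < 2 * n)%N by lia.
(* [S k] is the value on the rail entering vertex [k]. By [sn] both formulas agree at [k = n], and
   [S (2 * n) = S 0]. *)
pose S k := if (k <= n)%N then s k else - s (k - n)%N.
exists (fun e : ml_edge n => match e with
  | inl i => S (i : nat).+1 | inr i => s i - s i.+1 end); split.
- move=> u; rewrite arc_half_conservesE !big_sumType /=.
  have : S (u - 1)%R.+1 = S u.
    apply: val_Zp_sub1S.
    by rewrite (Zp_cast n2_gt1) /S leq0n ifN ?mul2n -?addnn ?addnK ?sn ?opprK //;
      lia.
  have : (fun i : 'Z_(2 * n) => i + 1 == u) =1 pred1 (u - 1).
    by move=> i; rewrite /= [i == _]eq_sym subr_eq [u == _]eq_sym.
  move: (u - 1) => w tgtuE sw.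
  rewrite (big_pred1 u) //= (big_pred1 w) //= sw {w tgtuE sw}.
  have lt_u : (u < 2 * n)%N by rewrite -{2}(Zp_cast n2_gt1).
  have srcE (i : 'I_n) : (i%:R == u) = (i == u :> nat).
    by rewrite -val_eqE /= val_Zp_nat // modn_small //; have := ltn_ord i; lia.
  have tgtE (i : 'I_n) : (i%:R + n%:R == u) = (i + n == u :> nat)%N.
    rewrite -natrD -val_eqE /= val_Zp_nat // modn_small //.
    by have := ltn_ord i; lia.
  rewrite (eq_bigl _ _ srcE) (eq_bigl _ _ tgtE).
  have [lt_un|le_nu] := ltnP u n.
    rewrite (big_pred1 (Ordinal lt_un)) //= big_pred0 => [|i]; last first.
      by apply/eqP; have := ltn_ord i; lia.
    by rewrite /S lt_un ltnW //; ring.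
  have lt_un : (u - n < n)%N by lia.
  rewrite big_pred0 => [|i]; last by apply/eqP; have := ltn_ord i; lia.
  rewrite (big_pred1 (Ordinal lt_un)) => [|i]; last first.
    by rewrite /= -val_eqE /=; lia.
  rewrite /= /S ltnNge le_nu /= subSn // leq_eqVlt [(u : nat) == n]eq_sym.
  rewrite ltnNge le_nu orbF.
  (* At [u = n] the value [S u] still comes from the first branch, and [sn] converts it. *)
  have [<-|_] := eqVneq n (u : nat); last by ring.
  by rewrite sn subnn; ring.
- case=> i; rewrite inE //= => _.
  by rewrite /S; case: ifP; rewrite ?oppr_eq0.
- by case=> i; rewrite inE //= => _; apply: sd.
by case=> i; rewrite inE //= => _; apply: sp.
Qed.

(* Deleting the edges of [X] amounts to forcing [psi] to vanish on them, so
   ladders with one rung are covered by those with two. *)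
Definition absorbs (G : mgraph) (R : {set edge G}) :=
  forall (X : {set edge G}) (phi : vertex G -> edge G -> 'F_3) v0 e0,
    X \subset R -> skew_half phi -> (forall v e, e \notin R -> phi v e = 0) ->
    e0 \in R :\: X -> phi v0 e0 != 0 ->
  exists psi : vertex G -> edge G -> 'F_3,
    [/\ skew_half psi, conserves psi, forall v e, e \in X -> psi v e = 0
      & forall v e, e \notin X -> v \in ends e -> psi v e + phi v e != 0].

(** With a constant value along each path, the contributions telescope and only the two original
    ends of the path remain. *)
Lemma sum_arc_half_sd (A : zmodType) (G : mgraph) (D : orientation G)
    (inner : edge G -> nat) (a : edge G -> A) (v : sd_vertex inner) :
  \sum_(x : sd_edge inner)
    arc_half (fun x : sd_edge inner => sd_path D inner (tag x) (tagged x))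
      (fun x : sd_edge inner => sd_path D inner (tag x) (tagged x).+1)
      (fun x => a (tag x)) v x =
  if v is inl u then \sum_e arc_half (arc_tail D) (arc_head D) a u e else 0.
Proof.
pose P e k := a e *+ (sd_path D inner e k == v).
transitivity (\sum_e \sum_(k < (inner e).+1) (P e k - P e k.+1)).
  rewrite (sig_big_dep xpredT (fun _ => xpredT)
    (fun e (k : 'I_(inner e).+1) => P e k - P e k.+1)) /=.
  exact: eq_bigr.
transitivity (\sum_e (P e 0%N - P e (inner e).+1)).
  apply: eq_bigr => e _.
  rewrite -(big_mkord xpredT (fun k => P e k - P e k.+1)).
  rewrite (telescope_sumr_eq (fun k => - P e k)) => [||k _].
  - by rewrite opprK addrC.
  - by [].
  by rewrite opprK addrC.
rewrite {}/P; case: v => u /=.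
  by apply: eq_bigr => e _; rewrite insubF ?ltnn.
by apply: big1 => e _; rewrite insubF ?ltnn //= subrr.
Qed.

(** Every edge of a path receives the value of the rail it subdivides. *)
Lemma subdivide_absorbs (L : ladder) (inner : edge L -> nat) :
  ladder_switch L -> (forall e, e \in rungs L -> inner e = 0%N) ->
  @absorbs (subdivide (ladder_dir L) inner)
    [set x : sd_edge inner | tag x \in rungs L].
Proof.
move=> switchL inner0 X phi v0 x0 XR phis phiR; rewrite !inE => /andP[x0X x0R].
set D := arc_orientation (@sd_path_neq L (ladder_dir L) inner).
set s := arc_tail D; set t := arc_head D.
pose p x := phi (s x) x.
have phiE : forall v x, phi v x = arc_half s t p v x := skew_arc_half D phis.
have phi_out v x : v \notin ends x -> phi v x = 0 by case: phis => + _; apply.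
(* The first edge on the path of [e]; for a rung it is the only one, so [X] and [p] can be read off
   on the ladder. *)
pose base e : sd_edge inner :=
  Tagged (fun e => 'I_(inner e).+1) (@ord0 (inner e)).
have baseE (x : sd_edge inner) : tag x \in rungs L -> x = base (tag x).
  case: x => e k /= /inner0 e0; congr (existT _ _ _); apply: val_inj => /=.
  by have := ltn_ord k; rewrite {2}e0; case: (k : nat).
move=> phi0.
have px0 : p x0 != 0.
  have v0x0 : v0 \in ends x0 by apply: contraNT phi0 => /phi_out ->.
  by move: phi0; rewrite phiE (arc_half_eq0 D _ v0x0).
have [|||a [ac arail aX aR]] := switchL (fun e => base e \in X)
  (fun e => p (base e)) (tag x0); rewrite -?baseE //.
exists (arc_half s t (fun x => a (tag x))); split.
- exact: (arc_half_skew D).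
- by move=> v; rewrite sum_arc_half_sd; case: v.
- move=> v x xX; have := subsetP XR x xX; rewrite inE => xR.
  by rewrite /arc_half aX -?baseE // !mul0rn subrr.
move=> v x xX vx; rewrite phiE.
rewrite [X in X != 0](_ : _ = arc_half s t (fun x => a (tag x) + p x) v x).
  rewrite (arc_half_eq0 D _ vx).
  have [xR|xR] := boolP (tag x \in rungs L).
    by rewrite {2}(baseE x xR) aR -?baseE.
  by rewrite /p phiR ?inE // addr0 arail.
by rewrite /arc_half !mulrnDl opprD addrACA.
Qed.

(** This serves both isomorphic copies and deletion of rungs. Edges of [H] outside the image join
    the deleted set, so the correction vanishes on them and stays conserved when pulled back. *)
Lemma embedding_absorbs (G H : mgraph) (f : vertex G -> vertex H)
    (g : edge G -> edge H) (R : {set edge G}) (S : {set edge H}) :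
  injective f -> injective g -> (forall e, ends (g e) = f @: ends e) ->
  (forall e, (g e \in S) = (e \in R)) ->
  (forall e', e' \notin codom g -> e' \in S) ->
  absorbs S -> absorbs R.
Proof.
move=> f_inj g_inj ends_fg RS codomS absS X phi v0 e0 XR phis phiR e0RX phi0.
pose X' := g @: X :|: [set e' | e' \notin codom g].
have gX e : (g e \in X') = (e \in X).
  by rewrite !inE codom_f orbF mem_imset.
have [|||||psi [psis psic psiX psi0]] :=
  absS X' (push_half f g phi) (f v0) (g e0).
- apply/subsetP=> e'; rewrite !inE => /orP[/imsetP[e eX ->]|/codomS //].
  by rewrite RS (subsetP XR).
- exact: push_half_skew.
- move=> v' e' e'S; have [/codomP[e e'E]|e'g] := boolP (e' \in codom g).
    rewrite /push_half big1 // => v _; apply: big1 => e1 /eqP e1E.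
    by rewrite phiR // -RS e1E.
  by rewrite (codomS _ e'g) in e'S.
- by move: e0RX; rewrite !in_setD gX RS.
- by rewrite push_halfE.
exists (fun v e => psi (f v) (g e)); split.
- exact: pull_half_skew.
- apply: pull_half_conserves => // v e' e'g; apply: psiX.
  by rewrite !inE e'g orbT.
- by move=> v e eX; apply: psiX; rewrite gX.
move=> v e eX ve; rewrite -(push_halfE f_inj g_inj phi) psi0 ?gX //.
by rewrite ends_fg imset_f.
Qed.

Lemma isomorphic_absorbs (G H : mgraph) (R : {set edge G}) (S : {set edge H}) :
  isomorphic R S -> absorbs R -> absorbs S.
Proof.
case=> f [g [[f' fK f'K] [g' gK g'K] ends_fg ->]].
apply: (embedding_absorbs (f := f') (g := g')).
- exact: can_inj f'K.
- exact: can_inj g'K.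
- move=> e; rewrite -{2}(g'K e) ends_fg -imset_comp.
  by rewrite (eq_imset (g := id)) ?imset_id.
- by move=> e; rewrite -{2}(g'K e) mem_imset //; apply: can_inj gK.
by move=> e /negP[]; rewrite -(gK e) codom_f.
Qed.

Lemma generalizes_absorbs (L : ladder) (H : mgraph) (R : {set edge H}) :
  ladder_switch L -> generalizes L R -> absorbs R.
Proof.
move=> switchL [inner [inner0 iso]].
exact: isomorphic_absorbs iso (subdivide_absorbs switchL inner0).
Qed.

Lemma generalized_ladder_absorbs (L : nat -> ladder) (H : mgraph)
    (R : {set edge H}) :
  (forall n, (2 <= n)%N -> ladder_switch (L n)) ->
  generalized_ladder L R -> absorbs R.
Proof.
move=> switchL [[n [n_ge2 genR]]|[H2 [R2 [X [genR2 XR2 _ iso]]]]].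
  exact: generalizes_absorbs (switchL n n_ge2) genR.
apply: isomorphic_absorbs iso _.
have := generalizes_absorbs (switchL 2%N isT) genR2.
apply: (@embedding_absorbs (delete_edges X) H2 val val).
- exact: val_inj.
- exact: val_inj.
- exact: ends_sub_val.
- by move=> e; rewrite inE.
move=> e; apply: contraNT => eR2.
have eX : e \in ~: X by rewrite inE; apply: contraNN eR2; apply: subsetP.
by rewrite -[e]/(val (Sub e eX : sub_edge (delete_edges X))) codom_f.
Qed.

Lemma closed_ladder_absorbs (H : mgraph) (R : {set edge H}) :
  generalized_closed_ladder R -> absorbs R.
Proof.
case; apply: generalized_ladder_absorbs => n.
  by move=> _; apply: circular_ladder_switch.
exact: moebius_ladder_switch.
Qed.

(** * Components *)

Section Component.
Variables (G : mgraph) (S : subgraph G).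

(** Taken on all vertices of [G], so that roots exist everywhere; vertices outside [S] are
    isolated. *)
Definition sub_adjacent : rel (vertex G) :=
  fun x y => [exists e in eset S, ends e == [set x; y]].

Lemma sub_adjacent_sym : symmetric sub_adjacent.
Proof. by move=> x y; apply: eq_existsb => e; rewrite setUC. Qed.

Lemma connect_vset x y :
  connect sub_adjacent x y -> (x \in vset S) = (y \in vset S).
Proof.
apply: closed_connect => u w /existsP[e /andP[/eset_closed/subsetP sub]].
move/eqP=> euw.
by rewrite !sub // euw !inE eqxx ?orbT.
Qed.

Definition comp_vset r := [set v in vset S | connect sub_adjacent r v].
Definition comp_eset r := [set e in eset S | ends e \subset comp_vset r].

Lemma comp_closed r e : e \in comp_eset r -> ends e \subset comp_vset r.
Proof. by rewrite inE => /andP[]. Qed.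

Definition component r : subgraph G := Subgraph (@comp_closed r).

Lemma comp_esetP r v e :
  e \in eset S -> v \in ends e -> connect sub_adjacent r v ->
  e \in comp_eset r.
Proof.
move=> eS ve rv; rewrite inE eS; apply/subsetP => w we.
rewrite inE (subsetP (eset_closed eS)) //=.
have [->//|wv] := eqVneq w v; apply: connect_trans rv (connect1 _).
apply/existsP; exists e.
rewrite eS /= eq_sym eqEcard card_ends cards2 eq_sym wv.
by rewrite andbT; apply/subsetP => z; rewrite !inE => /orP[] /eqP->.
Qed.

Lemma connect_comp r (x y : sub_vertex (component r)) :
  connect sub_adjacent (val x) (val y) ->
  connect (@adjacent (component r)) x y.
Proof.
move=> /connectP[p]; elim: p x => [|z p IHp] x /=.
  by move=> _ /val_inj ->; apply: connect0.
case/andP=> /existsP[e /andP[eS /eqP exz]] pth yl.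
have := valP x; rewrite inE => /andP[_ rx].
have eC : e \in comp_eset r.
  by apply: (comp_esetP (v := val x)); rewrite ?exz ?inE ?eqxx.
have zC : z \in comp_vset r.
  by rewrite (subsetP (comp_closed eC)) // exz !inE eqxx orbT.
pose z' : sub_vertex (component r) := Sub z zC.
apply: connect_trans (IHp z' pth yl); apply: connect1; apply/existsP.
exists (Sub e eC : sub_edge (component r)); apply/eqP/setP => w.
by rewrite !inE /= exz !inE.
Qed.

Lemma connect_sub_val (T : subgraph G) (x y : sub_vertex T) :
  eset T \subset eset S -> connect (@adjacent T) x y ->
  connect sub_adjacent (val x) (val y).
Proof.
move=> TS /connectP[p]; elim: p x => [|z p IHp] x /=.
  by move=> _ ->; apply: connect0.
case/andP=> /existsP[e /eqP exz] pth yl.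
apply: connect_trans (IHp z pth yl); apply: connect1; apply/existsP.
exists (val e); rewrite (subsetP TS) ?(valP e) //= ends_sub_val exz.
by rewrite imsetU !imset_set1.
Qed.

Lemma component_is_component r :
  r \in vset S -> is_component (component r) S.
Proof.
move=> rS; have rC : r \in comp_vset r by rewrite inE rS connect0.
split.
- by split; apply/subsetP => z; rewrite inE => /andP[].
- split; first by exists (Sub r rC : sub_vertex (component r)).
  move=> x y; apply: connect_comp.
  have := valP x; have := valP y; rewrite !inE => /andP[_ ry] /andP[_ rx].
  apply: connect_trans ry; rewrite sym_connect_sym //.
  exact: sub_adjacent_sym.
move=> T [TvS TeS] [_ Tconn] [CvT _].
have TvC : vset T \subset comp_vset r.
  apply/subsetP => v vT; rewrite inE (subsetP TvS) //=.
  (* A path in [T] from [r] is also a path in [S], so every vertex of [T] is in the class of [r]. *)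
  have rT := subsetP CvT r rC.
  exact: connect_sub_val TeS (Tconn (Sub r rT) (Sub v vT)).
split=> //; apply/subsetP => e eT; rewrite inE (subsetP TeS) //=.
exact: subset_trans (eset_closed eT) TvC.
Qed.

End Component.

(** * Correction on one component and gluing of the corrections *)

Lemma skew_halfD (A : zmodType) (G : mgraph) (h k : vertex G -> edge G -> A) :
  skew_half h -> skew_half k -> skew_half (fun v e => h v e + k v e).
Proof.
move=> [h0 hs] [k0 ks]; split=> [v e ve|e]; first by rewrite h0 ?k0 ?addr0.
by rewrite big_split /= hs ks addr0.
Qed.

Lemma push_sub_out (G : mgraph) (T : subgraph G) (A : zmodType)
    (h : vertex T -> edge T -> A) v e :
  e \notin eset T -> @push_half A T G val val h v e = 0.
Proof.
move=> eT; apply: push_half_out => e1.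
by apply: contraNneq eT => <-; apply: valP.
Qed.

Lemma push_subE (G : mgraph) (T : subgraph G) (A : zmodType)
    (h : vertex T -> edge T -> A) (v : sub_vertex T) (e : sub_edge T) :
  @push_half A T G val val h (val v) (val e) = h v e.
Proof. by apply: (@push_halfE A T G); apply: val_inj. Qed.

Lemma component_correction (G : mgraph) (T L : subgraph G)
    (phi : vertex G -> edge G -> 'F_3) (R : {set edge T}) :
  skew_half phi -> (forall v e, e \notin eset L -> phi v e = 0) ->
  (forall v e, e \in eset L -> v \in ends e -> phi v e != 0) ->
  generalized_closed_ladder R ->
  (eset T :&: eset L = set0 -> admits_nowhere_zero_flow 3 T) ->
  (forall e : sub_edge T, val e \in eset L -> e \in R) ->
  exists psi : vertex G -> edge G -> 'F_3,
    [/\ skew_half psi, conserves psi,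
        forall v e, e \notin eset T -> psi v e = 0
      & forall v e, e \in eset T -> v \in ends e -> phi v e + psi v e != 0].
Proof.
move=> phis phiL phi0 ladR flowT LR.
have ends_val := @ends_sub_val G T.
suff [psi [psis psic psi0]] : exists psi : vertex T -> edge T -> 'F_3,
    [/\ skew_half psi, conserves psi
      & forall (v : sub_vertex T) (e : sub_edge T),
        val v \in ends (val e) -> phi (val v) (val e) + psi v e != 0].
  exists (@push_half _ T G val val psi); split.
  - exact: push_half_skew.
  - exact: push_half_conserves.
  - by move=> v e; apply: push_sub_out.
  move=> v e eT ve; have vT := subsetP (eset_closed eT) v ve.
  have := push_subE psi (Sub v vT) (Sub e eT).
  by rewrite !SubK => ->; apply: psi0.
(* Without common edges [phi] vanishes on [T], and the flow of [T] itself serves as correction. *)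
have [TL|] := eqVneq (eset T :&: eset L) set0.
  have [psi [psis psic psi0]] := mod3_of_flow3 (flowT TL).
  exists psi; split=> // v e ve; rewrite phiL ?add0r ?psi0 ?inE //.
  apply/negP => eL; have := in_set0 (val e).
  by rewrite -TL inE eL (valP e).
case/set0Pn => e0; rewrite inE => /andP[e0T e0L].
have /set0Pn[v0 v0e0] : ends e0 != set0 by rewrite -card_gt0 card_ends.
have v0T := subsetP (eset_closed e0T) v0 v0e0.
(* Here no rung is deleted, and the common edge [e0] is the rung with nonzero value that makes the
   parity adjustable. *)
have [|||||psi [psis psic _ psi0]] := @closed_ladder_absorbs T R ladR set0
  (fun v e => phi (val v) (val e)) (Sub v0 v0T) (Sub e0 e0T).
- exact: sub0set.
- exact: (@pull_half_skew _ T G val val val_inj ends_val phi phis).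
- by move=> v e eR; apply: phiL; apply: contraNN eR; apply: LR.
- by rewrite setD0 LR ?SubK.
- by rewrite !SubK phi0.
by exists psi; split=> // v e ve; rewrite addrC psi0 ?inE.
Qed.

Theorem theorem3p3 (Gamma : mgraph) (Lambda Sigma : subgraph Gamma)
    (union_Gamma : is_union Lambda Sigma)
    (flow_Lambda : admits_nowhere_zero_flow 3 Lambda)
    (ladders_Sigma : forall Theta : subgraph Gamma,
      is_component Theta Sigma ->
      exists R : {set edge Theta},
        [/\ generalized_closed_ladder R,
            eset Theta :&: eset Lambda = set0 ->
              admits_nowhere_zero_flow 3 Theta
          & forall e : sub_edge Theta, val e \in eset Lambda -> e \in R]) :
  admits_nowhere_zero_flow 3 Gamma.
Proof.
have [h [hs hc h0]] := mod3_of_flow3 flow_Lambda.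
pose phi := @push_half _ Lambda Gamma val val h.
have phis : skew_half phi by apply: push_half_skew hs; apply: ends_sub_val.
have phic : conserves phi by apply: push_half_conserves.
have phiL v e : e \notin eset Lambda -> phi v e = 0 by apply: push_sub_out.
have phi0 v e : e \in eset Lambda -> v \in ends e -> phi v e != 0.
  move=> eL ve; have vL := subsetP (eset_closed eL) v ve.
  have := push_subE h (Sub v vL) (Sub e eL).
  by rewrite !SubK /phi => ->; apply: h0; rewrite inE.
have /fin_all_exists[psi psiP] (r : vertex Gamma) :
    exists psi : vertex Gamma -> edge Gamma -> 'F_3,
    [/\ skew_half psi, conserves psi,
        forall v e, e \notin eset Sigma -> psi v e = 0
      & r \in vset Sigma -> forall v e, e \in comp_eset Sigma r ->
          v \in ends e -> phi v e + psi v e != 0].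
  have [rS|rS] := boolP (r \in vset Sigma); last first.
    exists (fun _ _ => 0); split=> //; first by split=> // e; rewrite big1.
    by move=> v; rewrite big1.
  have [R [ladR flowR LR]] := ladders_Sigma _ (component_is_component rS).
  have [psi [psis psic psiS psi0]] :=
    component_correction phis phiL phi0 ladR flowR LR.
  exists psi; split=> // v e eS; apply: psiS.
  by rewrite inE negb_and eS.
pose adj := sub_adjacent Sigma.
have adj_sym : connect_sym adj.
  by apply: sym_connect_sym; apply: sub_adjacent_sym.
have rootE v e u : e \in eset Sigma -> v \in ends e -> u \in ends e ->
    fingraph.root adj v = fingraph.root adj u.
  move=> eS ve ue; apply/eqP; rewrite root_connect //.
  have := comp_esetP eS ve (connect0 _ v); rewrite inE => /andP[_].
  by move=> /subsetP/(_ u ue); rewrite inE => /andP[].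
(* Each vertex uses the correction of its own component. Indexing by the root makes both ends of an
   edge of [Sigma] select the same correction. *)
apply: (@flow3_of_mod3 Gamma
  (fun v e => phi v e + psi (fingraph.root adj v) v e)).
- apply: skew_halfD => //; split=> [v e ve|e].
    by have [[-> //]] := psiP (fingraph.root adj v).
  have [eS|eS] := boolP (e \in eset Sigma); last first.
    by apply: big1 => v _; have [_ _ ->] := psiP (fingraph.root adj v).
  have /set0Pn[u ue] : ends e != set0 by rewrite -card_gt0 card_ends.
  have [[_ psis] _ _ _] := psiP (fingraph.root adj u).
  rewrite -[RHS](psis e); apply: eq_bigr => v _.
  have [ve|ve] := boolP (v \in ends e); first by rewrite (rootE v e u).
  have [[-> // _] _ _ _] := psiP (fingraph.root adj v).
  by have [[-> //]] := psiP (fingraph.root adj u).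
- move=> v; rewrite big_split /= phic add0r.
  by have [_ ->] := psiP (fingraph.root adj v).
move=> v e ve.
(* Outside [Sigma] all corrections vanish, and the edge lies in [Lambda], where [phi] is nonzero. *)
have [eS|eS] := boolP (e \in eset Sigma); last first.
  have [_ _ -> // _] := psiP (fingraph.root adj v); rewrite addr0 phi0 //.
  have [_ /setP/(_ e)] := union_Gamma.
  by rewrite !inE (negbTE eS) orbF => ->.
have rv : connect adj (fingraph.root adj v) v by rewrite adj_sym connect_root.
have vS := subsetP (eset_closed eS) v ve.
have [_ _ _ ->] := psiP (fingraph.root adj v); rewrite ?(connect_vset rv) //.
exact: comp_esetP rv.
Qed.
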